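(* Let $\Omega$ be a compact Hausdorff space and $X$ a real or complex Banach space. Let $f\in S(C(\Omega,X))$ and $\Lambda=\{\omega\in\Omega:\|f(\omega)\|=1\}$. If $\Lambda$ is finite and $S_{f(\omega)}$ is norm compact for each $\omega\in\Lambda$, then $S_f$ is norm compact. In addition, if we assume $\overline{\mathrm{ext}(X_1^* )}^{\,w^*}\subseteq S(X^* )$, then the converse is also true; that is, if $S_f$ is norm compact, then $\Lambda$ is finite and $S_{f(\omega)}$ is norm compact for each $\omega\in\Lambda$.
   Context: $C(\Omega,X)$ is the Banach space of $X$-valued continuous functions on $\Omega$ with the supremum norm. For a Banach space $E$, $S(E)$ is its unit sphere, and for $e\in S(E)$ the state space is $S_e=\{e^*\in S(E^* ):e^*(e)=1\}\subseteq E^*$; $S_f$ is taken with $E=C(\Omega,X)$ and $S_{f(\omega)}$ (for $\omega\in\Lambda$) with $E=X$. $X_1^*$ is the closed unit ball of $X^*$, $\mathrm{ext}$ denotes the set of extreme points, and $\overline{\,\cdot\,}^{\,w^*}$ denotes closure in the weak$^*$ topology. Norm compact means compact in the norm topology of the corresponding dual space. *)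

(* Defs.v *)
From HB Require Import structures.
From mathcomp Require Import all_boot all_order all_algebra.
From mathcomp Require Import complex.
From mathcomp Require Import all_classical all_reals all_analysis.

Set Implicit Arguments.
Unset Strict Implicit.
Unset Printing Implicit Defensive.

Import Order.TTheory GRing.Theory Num.Theory.
Import numFieldNormedType.Exports.

Local Open Scope classical_set_scope.
Local Open Scope ring_scope.

Variant scalar_kind := RealScalars | ComplexScalars.

Definition scalar_field (R : realType) (k : scalar_kind) : numFieldType :=
  match k with RealScalars => R | ComplexScalars => R[i] end.

(* Norms take their values in the scalar field, which is only partially
   ordered when it is R[i]. Suprema of sets of norms exist there nonetheless,
   since x <= y in R[i] means that y - x is a nonnegative real. *)
Lemma scalar_supremums (R : realType) (k : scalar_kind)
    (A : set (scalar_field R k)) :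
  A !=set0 -> A `<=` [set x | 0 <= x] -> has_ubound A -> supremums A !=set0.
Proof.
case: k A => /= A A0 Age0 Aub.
  exists (sup A); split; first exact: (@ub_le_sup _ A).
  by move=> y yA; exact: ge_sup.
have ReE (z : R[i]) : 0 <= z -> z = (complex.Re z)%:C%C.
  by case: z => a b; rewrite lecE /= => /andP[/eqP -> _].
have [a Aa] := A0; have [M MA] := Aub.
have RA0 : [set complex.Re z | z in A] !=set0 by exists (complex.Re a), a.
have ub_ge0 (y : R[i]) : ubound A y -> 0 <= y.
  by move=> yA; rewrite (le_trans (Age0 _ Aa))// yA.
have ubRe (y : R[i]) : ubound A y -> ubound [set complex.Re z | z in A] (complex.Re y).
  move=> yA _ [z Az <-]; move: (yA z Az).
  by rewrite (ReE _ (ub_ge0 _ yA)) (ReE _ (Age0 _ Az)) lecR.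
exists (sup [set complex.Re z | z in A])%:C%C; split=> [z Az|y yA].
  rewrite (ReE _ (Age0 _ Az)) lecR; apply: (@ub_le_sup _ [set complex.Re z | z in A]).
    by exists (complex.Re M); exact: ubRe.
  by exists z.
by rewrite (ReE _ (ub_ge0 _ yA)) lecR; apply: ge_sup => //; exact: ubRe.
Qed.

Section scalar_supremum.
Variables (R : realType) (k : scalar_kind).
Local Notation K := (scalar_field R k).
Variable A : set K.
Hypothesis Age0 : A `<=` [set x | 0 <= x].

Lemma scalar_supremum_ub (x : K) : has_ubound A -> A x -> x <= supremum 0 A.
Proof.
move=> Aub Ax; have A0 : A !=set0 by exists x.
rewrite /supremum ifF; last by apply/eqP => A00; rewrite A00 in Ax.
case: xgetP => [y _ [uy _]|no]; first exact: uy.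
by have [y /no] := scalar_supremums A0 Age0 Aub.
Qed.

Lemma scalar_supremum_le (M : K) : 0 <= M -> ubound A M -> supremum 0 A <= M.
Proof.
move=> M0 AM; rewrite /supremum; case: ifPn => [//|/set0P A0].
have Aub : has_ubound A by exists M.
case: xgetP => [y _ [_ ly]|no]; first exact: ly.
by have [y /no] := scalar_supremums A0 Age0 Aub.
Qed.

End scalar_supremum.

HB.mixin Record isCompactHausdorff T & Topological T := {
  compact_setT : compact [set: T];
  hausdorff : hausdorff_space T
}.

#[short(type="compactHausdorffType")]
HB.structure Definition CompactHausdorff :=
  {T of Topological T & isCompactHausdorff T}.

Section cfun.
Variables (R : realType) (k : scalar_kind).
Local Notation K := (scalar_field R k).
Variables (Omega : compactHausdorffType) (X : normedModType K).

Definition continuous_pred : {pred Omega -> X} :=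
  [pred f : Omega -> X | `[< continuous f >]].

Lemma continuous_pred_submod : submod_closed continuous_pred.
Proof.
split=> [|a f g]; rewrite !inE; first by move=> x; exact: cvg_cst.
move=> cf cg x.
by apply: cvgD; [apply: cvgZr; exact: cf|exact: cg].
Qed.

HB.instance Definition _ :=
  GRing.isSubmodClosed.Build K _ continuous_pred continuous_pred_submod.

Record cfun := CFun {
  cfun_val :> Omega -> X;
  cfun_valP : cfun_val \in continuous_pred }.

HB.instance Definition _ := [isSub for cfun_val].
HB.instance Definition _ := [Choice of cfun by <:].
HB.instance Definition _ := [SubChoice_isSubLmodule of cfun by <:].

Lemma cfun_continuous (f : cfun) : continuous f.
Proof. by have := cfun_valP f; rewrite inE. Qed.

Definition sup_norm (f : cfun) : K := supremum 0 (range (fun w => `|f w|)).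

Let range_ge0 (f : cfun) :
  range (fun w => `|f w|) `<=` [set x | 0 <= x].
Proof. by move=> _ [w _ <-] /=. Qed.

Let range_ub (f : cfun) : has_ubound (range (fun w => `|f w|)).
Proof.
suff : \forall M \near +oo_K, [set: Omega] `<=` [set w | `|f w| <= M].
  by move=> /filter_ex[M fM]; exists M => _ [w _ <-]; exact: fM.
apply: ((compact_near_coveringP [set: Omega]).1 compact_setT) => w _.
have fw1 : \forall w' \near w, `|f w'| <= `|f w| + 1.
  have := @cfun_continuous f w.
  move=> /cvgrPdist_le /(_ 1 ltr01); apply: filterS => w' ww'.
  by rewrite -[f w'](subKr (f w)) (le_trans (ler_normB _ _))// lerD2l.
exists ([set w' | `|f w'| <= `|f w| + 1], [set M | `|f w| + 1 <= M]) => /=.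
  by split=> //; apply: nbhs_pinfty_ge; rewrite realD// ?normr_real ?real1.
by case=> w' M /= [h1 h2]; exact: le_trans h2.
Qed.

Lemma sup_norm_ub (f : cfun) w : `|f w| <= sup_norm f.
Proof.
by apply: scalar_supremum_ub; [exact: range_ge0|exact: range_ub|exists w].
Qed.

Lemma sup_norm_le (f : cfun) (M : K) :
  0 <= M -> (forall w, `|f w| <= M) -> sup_norm f <= M.
Proof.
move=> M0 fM; apply: (scalar_supremum_le (@range_ge0 f)) => //.
by move=> _ [w _ <-].
Qed.

Lemma sup_norm_ge0 f : 0 <= sup_norm f.
Proof.
rewrite /sup_norm; have [->|/set0P[_ [w _ _]]] :=
  eqVneq (range (fun w => `|f w|)) set0; first by rewrite supremum0.
exact: le_trans (sup_norm_ub f w).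
Qed.

Let sup_normD (f g : cfun) : sup_norm (f + g) <= sup_norm f + sup_norm g.
Proof.
apply: sup_norm_le => [|w]; first by rewrite addr_ge0 ?sup_norm_ge0.
by rewrite (le_trans (ler_normD _ _))// lerD ?sup_norm_ub.
Qed.

Let sup_norm0_eq0 (f : cfun) : sup_norm f = 0 -> f = 0.
Proof.
move=> f0; apply/val_inj/funext => w /=.
by apply/eqP; rewrite -normr_le0 -f0 sup_norm_ub.
Qed.

Let sup_normZ_le (a : K) (f : cfun) : sup_norm (a *: f) <= `|a| * sup_norm f.
Proof.
apply: sup_norm_le => [|w]; first by rewrite mulr_ge0 ?sup_norm_ge0.
by rewrite normrZ ler_wpM2l ?sup_norm_ub.
Qed.

Let sup_normZ (a : K) (f : cfun) : sup_norm (a *: f) = `|a| * sup_norm f.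
Proof.
apply/eqP; rewrite eq_le sup_normZ_le /=.
have [->|a0] := eqVneq a 0; first by rewrite normr0 mul0r sup_norm_ge0.
rewrite -ler_pdivlMl ?normr_gt0// -normfV -{1}(scale1r f) -(mulVf a0).
by rewrite -scalerA sup_normZ_le.
Qed.

HB.instance Definition _ :=
  Lmodule_isNormed.Build K cfun sup_normD sup_normZ sup_norm0_eq0.

End cfun.

Section dual.
Variables (R : realType) (k : scalar_kind).
Local Notation K := (scalar_field R k).
Variable E : normedModType K.

Definition functional_pred : {pred E -> K^o} :=
  [pred phi : E -> K^o | `[< linear phi /\ continuous phi >]].

Lemma functional_pred_submod : submod_closed functional_pred.
Proof.
split=> [|a f g]; rewrite !inE.
  split; last by move=> x; exact: cvg_cst.
  by move=> a x y /=; rewrite scaler0 addr0.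
move=> [lf cf] [lg cg]; split.
  move=> b x y; rewrite /= [LHS](_ : _ = a *: f (b *: x + y) + g (b *: x + y))//.
  rewrite lf lg [RHS](_ : _ = b *: (a *: f x + g x) + (a *: f y + g y))//.
  by rewrite !scalerDr !scalerA (mulrC a b) addrACA.
by move=> x; apply: cvgD; [apply: cvgZr; exact: cf|exact: cg].
Qed.

HB.instance Definition _ :=
  GRing.isSubmodClosed.Build K _ functional_pred functional_pred_submod.

Record dual := Dual {
  dual_val :> E -> K^o;
  dual_valP : dual_val \in functional_pred }.

HB.instance Definition _ := [isSub for dual_val].
HB.instance Definition _ := [Choice of dual by <:].
HB.instance Definition _ := [SubChoice_isSubLmodule of dual by <:].

Lemma dual_linear (phi : dual) : linear phi.
Proof. by have := dual_valP phi; rewrite inE => -[]. Qed.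

Lemma dual_continuous (phi : dual) : continuous phi.
Proof. by have := dual_valP phi; rewrite inE => -[]. Qed.

HB.instance Definition _ (phi : dual) :=
  GRing.isLinear.Build K E K^o *:%R (dual_val phi) (dual_linear phi).

Definition op_norm (phi : dual) : K :=
  supremum 0 [set `|phi x| | x in [set x : E | `|x| <= 1]].

Let range_ge0 (phi : dual) :
  [set `|phi x| | x in [set x : E | `|x| <= 1]] `<=` [set x | 0 <= x].
Proof. by move=> _ [w _ <-] /=. Qed.

Let range_ub (phi : dual) :
  has_ubound [set `|phi x| | x in [set x : E | `|x| <= 1]].
Proof.
have /bounded_funP /(_ 1)[M phiM] :=
  (linear_bounded_continuous (dual_val phi)).2 (@dual_continuous phi).
by exists M => _ [x x1 <-]; exact: phiM.
Qed.

Lemma op_norm_ub (phi : dual) x : `|x| <= 1 -> `|phi x| <= op_norm phi.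
Proof.
move=> x1.
by apply: scalar_supremum_ub; [exact: range_ge0|exact: range_ub|exists x].
Qed.

Lemma op_norm_le (phi : dual) (M : K) :
  0 <= M -> (forall x, `|x| <= 1 -> `|phi x| <= M) -> op_norm phi <= M.
Proof.
move=> M0 fM; apply: (scalar_supremum_le (@range_ge0 phi)) => //.
by move=> _ [w w1 <-]; exact: fM.
Qed.

Lemma op_norm_ge0 phi : 0 <= op_norm phi.
Proof. by apply: le_trans (@op_norm_ub phi 0 _); rewrite ?normr0. Qed.

Lemma le_op_norm (phi : dual) x : `|phi x| <= op_norm phi * `|x|.
Proof.
have [->|x0] := eqVneq x 0; first by rewrite linear0 !normr0 mulr0.
have nx0 : 0 < `|x| by rewrite normr_gt0.
rewrite -ler_pdivrMr// mulrC -(gtr0_norm nx0) -normfV -normrM.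
rewrite -[_ * phi x]/(`|x|^-1 *: phi x) -linearZ op_norm_ub//.
by rewrite normrZ normfV normr_id mulVf ?gt_eqF.
Qed.

Let op_normD (phi psi : dual) : op_norm (phi + psi) <= op_norm phi + op_norm psi.
Proof.
apply: op_norm_le => [|x x1]; first by rewrite addr_ge0 ?op_norm_ge0.
by rewrite (le_trans (ler_normD _ _))// lerD ?op_norm_ub.
Qed.

Let op_norm0_eq0 (phi : dual) : op_norm phi = 0 -> phi = 0.
Proof.
move=> f0; apply/val_inj/funext => x /=.
by apply/eqP; rewrite -normr_le0 (le_trans (le_op_norm _ _))// f0 mul0r.
Qed.

Let op_normZ_le (a : K) (phi : dual) : op_norm (a *: phi) <= `|a| * op_norm phi.
Proof.
apply: op_norm_le => [|x x1]; first by rewrite mulr_ge0 ?op_norm_ge0.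
by rewrite [X in X <= _]normrM ler_wpM2l ?op_norm_ub.
Qed.

Let op_normZ (a : K) (phi : dual) : op_norm (a *: phi) = `|a| * op_norm phi.
Proof.
apply/eqP; rewrite eq_le op_normZ_le /=.
have [->|a0] := eqVneq a 0; first by rewrite normr0 mul0r op_norm_ge0.
rewrite -ler_pdivlMl ?normr_gt0// -normfV -{1}(scale1r phi) -(mulVf a0).
by rewrite -scalerA op_normZ_le.
Qed.

HB.instance Definition _ :=
  Lmodule_isNormed.Build K dual op_normD op_normZ op_norm0_eq0.

Definition weak_star : topologicalType :=
  initial_topology (fun phi : dual => (phi : {ptws E -> K^o})).

Definition weak_star_closure (A : set dual) : set dual :=
  closure (A : set weak_star).

End dual.

Section geometry.
Variables (K : numFieldType) (V : normedModType K).

Definition unit_sphere : set V := [set x | `|x| = 1].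

Definition unit_ball : set V := [set x | `|x| <= 1].

(* Over R[i], the condition 0 < t < 1 forces t to be real. *)
Definition extreme_points (A : set V) : set V :=
  [set x | A x /\ forall (y z : V) (t : K), A y -> A z -> 0 < t < 1 ->
    x = t *: y + (1 - t) *: z -> y = x /\ z = x].

End geometry.

Arguments unit_sphere {K} V.
Arguments unit_ball {K} V.

Definition state_space (R : realType) (k : scalar_kind)
    (E : normedModType (scalar_field R k)) (e : E) : set (dual E) :=
  [set phi | unit_sphere (dual E) phi /\ phi e = 1].

(* Main.v *)
From HB Require Import structures.
Require Import Defs.
From mathcomp Require Import all_boot all_order all_algebra.
From mathcomp Require Import complex ring lra.
From mathcomp Require Import all_classical all_reals all_analysis.

(** A functional phi in S_f satisfies |phi g| <= M as soon as |g| <= M on the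
    set Lambda where f peaks: off Lambda the norm of T f + c g stays below
    T + M + e for T large and |c| = 1, whereas phi (T f + c g) = T + c phi g.
    So phi only depends on the restriction of g to Lambda. When Lambda is
    finite, Urysohn functions split phi into a convex combination of
    functionals g |-> psi (g w) with w in Lambda and psi in S_(f w), so that
    S_f is a closed subset of a finite sum of compact sets.
    Conversely, psi |-> (g |-> psi (g w)) embeds S_(f w) isometrically onto a
    closed subset of S_f, and functionals obtained in this way (by
    Hahn-Banach) at distinct points of Lambda are at distance at least 1. *)

Set Implicit Arguments.
Unset Strict Implicit.
Unset Printing Implicit Defensive.

Import Order.TTheory GRing.Theory Num.Theory.
Import numFieldNormedType.Exports.

Local Open Scope classical_set_scope.
Local Open Scope ring_scope.

(** * Hahn-Banach for real-linear functionals, the reals acting on the module through [iota] *)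

Section hahn_banach.
Variables (R : realType) (K : pzRingType) (iota : {rmorphism R -> K}).
Variables (V : lmodType K) (p : V -> R).
Hypothesis pD : forall x y, p (x + y) <= p x + p y.
Hypothesis pZ : forall t x, 0 < t -> p (iota t *: x) = t * p x.

(** Partial functionals are kept as relations, so that chains are joined by plain unions;
    single-valuedness is not imposed, since domination by [p] implies it. *)
Let dominated_graph (G : set (V * R)) :=
  [/\ forall t x y, G x -> G y -> G (iota t *: x.1 + y.1, t * x.2 + y.2),
      forall x, G x -> x.2 <= p x.1 & G (0, 0)].

Let p0 : p 0 = 0.
Proof.
have := pZ 0 (ltr0Sn R 1); rewrite scaler0 => /eqP.
by rewrite mulr2n mulrDl mul1r -subr_eq0 opprD addNKr oppr_eq0 => /eqP.
Qed.

Let dominated_scale G t x : dominated_graph G -> G x ->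
  G (iota t *: x.1, t * x.2).
Proof. by case=> GD _ G0 Gx; have := GD t x _ Gx G0; rewrite /= !addr0. Qed.

(** Subtracting the two pairs puts [(0, s - r)] and [(0, r - s)] in [G], and both values are at most
    [p 0 = 0]. *)
Let dominated_fun G x r s : dominated_graph G -> G (x, r) -> G (x, s) -> r = s.
Proof.
case=> GD Gp _ Gr Gs.
have := Gp _ (GD (-1) _ _ Gr Gs); have := Gp _ (GD (-1) _ _ Gs Gr).
rewrite /= rmorphN1 scaleN1r addNr p0 => h1 h2; lra.
Qed.

(* Any c between sup (r - p (y - x)) and inf (p (y + x) - r), (y, r) in G,
   is an admissible value at x. *)
Let dominated_extend G x : dominated_graph G ->
  exists2 G', dominated_graph G' & G `<=` G' /\ exists r, G' (x, r).
Proof.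
move=> dG; have [GD Gp G0] := dG.
pose L := [set z.2 - p (z.1 - x) | z in G].
have LU z w : G z -> G w -> z.2 - p (z.1 - x) <= p (w.1 + x) - w.2.
  move=> Gz Gw; have := Gp _ (GD 1 _ _ Gz Gw); rewrite rmorph1 scale1r mul1r /=.
  have := pD (z.1 - x) (w.1 + x); rewrite addrACA addNr addr0; lra.
have L0 : L !=set0 by exists (0 - p (0 - x)), (0, 0).
pose c := sup L.
have Lc z : G z -> z.2 - p (z.1 - x) <= c.
  move=> Gz; apply: ub_le_sup; last by exists z.
  by exists (p (0 + x) - 0) => _ [w Gw <-]; exact: (LU w (0, 0)).
have cU w : G w -> c <= p (w.1 + x) - w.2.
  by move=> Gw; apply: ge_sup => // _ [z Gz <-]; exact: LU.
exists [set z | exists w t, G w /\ z = (w.1 + iota t *: x, w.2 + t * c)].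
  split.
  - move=> t _ _ [w [a [Gw ->]]] [v [b [Gv ->]]].
    exists (iota t *: w.1 + v.1, t * w.2 + v.2), (t * a + b).
    split; first exact: GD.
    congr pair => /=; last by ring.
    rewrite rmorphD rmorphM scalerDr scalerDl scalerA -!addrA; congr +%R.
    by rewrite addrCA.
  - move=> _ [w [t [Gw ->]]] /=.
    have [t0|t0|->] := ltgtP t 0.
    (* Dividing by [- t] turns the coefficient of [x] into -1, the case covered by [Lc]; positive
       [t] reduces to [cU] in the same way. *)
    + have s0 : 0 < - t by lra.
      have := Lc _ (dominated_scale (- t)^-1 dG Gw) => /=.
      rewrite -(ler_pM2l s0) mulrBr -pZ// scalerBr scalerA -rmorphM.
      rewrite mulrA mulfV ?gt_eqF// rmorph1 scale1r mul1r rmorphN scaleNr.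
      rewrite opprK; lra.
    + have := cU _ (dominated_scale t^-1 dG Gw) => /=.
      rewrite -(ler_pM2l t0) mulrBr -pZ// scalerDr scalerA -rmorphM.
      rewrite mulrA mulfV ?gt_eqF// rmorph1 scale1r mul1r; lra.
    + by rewrite rmorph0 scale0r addr0 mul0r addr0 Gp.
  - by exists (0, 0), 0; rewrite rmorph0 scale0r mul0r !addr0.
split; last by exists c, (0, 0), 1; rewrite rmorph1 scale1r mul1r !add0r.
move=> w Gw; exists w, 0.
by rewrite rmorph0 scale0r mul0r !addr0 -surjective_pairing.
Qed.

Let dominated_line x0 :
  dominated_graph [set z | exists t, z = (iota t *: x0, t * p x0)].
Proof.
split; last by exists 0; rewrite rmorph0 scale0r mul0r.
  move=> t _ _ [a ->] [b ->]; exists (t * a + b) => /=.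
  by rewrite rmorphD rmorphM scalerDl scalerA mulrDl mulrA.
move=> _ [t ->] /=; have [t0|t0|->] := ltgtP t 0; last 2 first.
- by rewrite pZ.
- by rewrite rmorph0 scale0r mul0r p0.
have s0 : 0 < - t by lra.
have := pD (iota t *: x0) (iota (- t) *: x0).
rewrite -scalerDl -rmorphD subrr rmorph0 scale0r p0 (pZ x0 s0); lra.
Qed.

Lemma hahn_banach (x0 : V) : exists u : V -> R,
  [/\ forall t x y, u (iota t *: x + y) = t * u x + u y,
      forall x, u x <= p x & u x0 = p x0].
Proof.
pose line := [set z | exists t, z = (iota t *: x0, t * p x0)].
(* Joining [line] to every graph makes the empty chain admissible and forces the value [p x0] at
   [x0]. *)
have [F FP Ftot|G [dG Gmax]] := @Zorn_bigcup _
  [set G | dominated_graph (G `|` line)].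
  have [->|/set0P[G0 FG0]] := eqVneq F set0.
    by rewrite /= bigcup_set0 set0U; exact: dominated_line.
  have common z w : ((\bigcup_(X in F) X) `|` line) z ->
      ((\bigcup_(X in F) X) `|` line) w ->
      exists2 G, F G & (G `|` line) z /\ (G `|` line) w.
    move=> [[G FG Gz]|Lz] [[H FH Hw]|Lw].
    - have [GH|HG] := Ftot _ _ FG FH.
        by exists H => //; split; left => //; exact: GH.
      by exists G => //; split; left => //; exact: HG.
    - by exists G => //; split; [left|right].
    - by exists H => //; split; [right|left].
    - by exists G0 => //; split; right.
  have sub G : F G -> G `|` line `<=` (\bigcup_(X in F) X) `|` line.
    by move=> FG z [Gz|Lz]; [left; exists G|right].
  split.
  - move=> t z w Uz Uw; have [G FG [Gz Gw]] := common _ _ Uz Uw.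
    by apply: (sub _ FG); have [GD _ _] := FP _ FG; exact: GD.
  - move=> z Uz; have [G FG [Gz _]] := common _ _ Uz Uz.
    by have [_ Gp _] := FP _ FG; exact: Gp.
  - by apply: (sub _ FG0); have [_ _] := FP _ FG0.
(* A point outside the domain would allow a proper extension of [G], against maximality. *)
have total x : exists r, (G `|` line) (x, r).
  have [G' dG' [GG' [r G'x]]] := dominated_extend x dG.
  exists r; apply: contrapT => nGx; apply: (Gmax G').
    split; first by move=> z Gz; apply: GG'; left.
    by move=> /(_ _ G'x) Gx; apply: nGx; left.
  rewrite /= (_ : G' `|` line = G')//.
  by apply/setUidPl => z Lz; apply: GG'; right.
pose u x := projT1 (cid (total x)).
have Gu x : (G `|` line) (x, u x) by exact: projT2 (cid (total x)).
have [GD Gp _] := dG.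
exists u; split.
- move=> t x y; apply: dominated_fun dG (Gu _) _.
  exact: (GD t _ _ (Gu x) (Gu y)).
- by move=> x; exact: (Gp _ (Gu x)).
- apply: dominated_fun dG (Gu _) _; right; exists 1.
  by rewrite rmorph1 scale1r mul1r.
Qed.

End hahn_banach.

Lemma linear_bound_continuous (K : numFieldType) (V W : normedModType K)
  (T : {linear V -> W}) (M : K) :
  0 <= M -> (forall x, `|T x| <= M * `|x|) -> continuous T.
Proof.
move=> M0 TM; apply: (linear_bounded_continuous T).1; apply/bounded_funP => r.
by exists (M * r) => x xr; apply: le_trans (TM x) _; rewrite ler_wpM2l.
Qed.

(** * Real numbers and real parts in the scalar field *)

Section scalars.
Variables (R : realType).

Definition of_real (k : scalar_kind) : R -> scalar_field R k :=
  match k with RealScalars => id | ComplexScalars => real_complex R end.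

Definition re_part (k : scalar_kind) : scalar_field R k -> R :=
  match k with RealScalars => id | ComplexScalars => @complex.Re R end.

Lemma of_real_zmod_morphism k : zmod_morphism (@of_real k).
Proof. by case: k => //= x y; rewrite rmorphB. Qed.

HB.instance Definition _ k := GRing.isZmodMorphism.Build R (scalar_field R k)
  (@of_real k) (of_real_zmod_morphism k).

Lemma of_real_monoid_morphism k : monoid_morphism (@of_real k).
Proof.
by case: k; split=> //= x y; rewrite rmorphM.
Qed.

HB.instance Definition _ k := GRing.isMonoidMorphism.Build R (scalar_field R k)
  (@of_real k) (of_real_monoid_morphism k).

Lemma ler_of_real k x y : (of_real k x <= of_real k y) = (x <= y).
Proof. by case: k => //=; rewrite lecR. Qed.

Lemma of_realK k x : re_part (of_real k x) = x.
Proof. by case: k. Qed.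

Lemma re_partK k (z : scalar_field R k) : 0 <= z -> of_real k (re_part z) = z.
Proof. by case: k z => //= -[a b]; rewrite lecE /= => /andP[/eqP -> _]. Qed.

Lemma normr_of_real k x : `|of_real k x| = of_real k `|x|.
Proof. by case: k => //=; rewrite normc_def /= expr0n addr0 sqrtr_sqr. Qed.

Lemma of_real_continuous k : continuous (@of_real k).
Proof.
case: k => /=; first by move=> x; exact: cvg_id.
move=> x; apply/cvgrPdist_lt => e e0.
have eE : (complex.Re e)%:C%C = e.
  exact: (@re_partK ComplexScalars _ (ltW e0)).
rewrite -eE.
have : 0 < complex.Re e by move: e0; rewrite ltcE => /andP[].
move=> e0'; near=> y.
have nE (u : R) : `|u%:C%C| = `|u|%:C%C := normr_of_real ComplexScalars u.
rewrite -rmorphB nE ltcR; near: y.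
by apply: cvgr_dist_lt => //; exact: cvg_id.
Unshelve. all: by end_near. Qed.

(** For [z = a + ib] and [r = |z|], the real part of the bound gives [r <= a], while
    [r ^ 2 = a ^ 2 + b ^ 2]; hence [b = 0] and [a = r]. *)
Lemma eq_normr_disc k (z : scalar_field R k) :
  `|1 - z + `|z| | <= 1 -> z = `|z|.
Proof.
case: k z => /=.
  move=> z /(le_trans (ler_norm _)) h; apply/eqP.
  by rewrite eq_le ler_norm /=; lra.
move=> [a b] h.
have [r rE] : exists r : R, `|(a +i* b)%C| = r%:C%C.
  by eexists; rewrite normc_def.
rewrite rE in h *.
have ra : r <= a.
  have := le_trans (normc_ge_Re _) h; rewrite /= lecR.
  by move=> /(le_trans (ler_norm _)); lra.
have r2 : r ^+ 2 = a ^+ 2 + b ^+ 2.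
  have := add_Re2_Im2 (a +i* b)%C; rewrite rE /= -rmorphXn.
  by move=> /complexI ->.
have r0 : 0 <= r by rewrite -lecR -rE; exact: normr_ge0.
have b0 : b = 0.
  apply/eqP; rewrite -sqrf_eq0; apply/eqP; nra.
have -> : r = a by apply/eqP; rewrite -subr_eq0 -sqrf_eq0; apply/eqP; nra.
by rewrite b0.
Qed.

End scalars.

Lemma eq1_re_part (R : realType) k (z : scalar_field R k) :
  `|z| <= 1 -> re_part z = 1 -> z = 1.
Proof.
case: k z => //= -[a b] z1 /= a1; subst a.
have b2 : 1 ^+ 2 + b ^+ 2 <= 1.
  by rewrite -lecR (add_Re2_Im2 (1 +i* b)%C) exprn_ile1.
by have -> : b = 0 by apply/eqP; rewrite -sqrf_eq0; apply/eqP; nra.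
Qed.

(** In the complex case [phi x = u x - i u (i x)]. The bound on [u] passes to [phi] after rotating
    [x] so that its value becomes [|phi x|]. *)
Lemma functional_of_real_part (R : realType) k
    (E : normedModType (scalar_field R k)) (u : E -> R) :
  (forall t x y, u (of_real k t *: x + y) = t * u x + u y) ->
  (forall x, of_real k (u x) <= `|x|) ->
  exists phi : E -> (scalar_field R k)^o,
    [/\ linear phi, forall x, `|phi x| <= `|x| &
      forall x, re_part (phi x) = u x].
Proof.
move=> uL u1.
suff [phi phiL phiu] : exists2 phi : E -> (scalar_field R k)^o,
    linear phi & forall x, re_part (phi x) = u x.
  exists phi; split=> // x.
  have [->|z0] := eqVneq (phi x) 0; first by rewrite normr0.
  pose c := `|phi x| / phi x.
  have c1 : `|c| = 1 by rewrite normrM normr_id normfV mulfV ?normr_eq0.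
  rewrite -[leRHS]mul1r -c1 -normrZ; apply: le_trans (u1 _).
  have cx : phi (c *: x) = `|phi x|.
    have phi0 : phi 0 = 0.
      by have := phiL (-1) 0 0; rewrite scaler0 addr0 scaleN1r addNr.
    by have := phiL c x 0; rewrite !addr0 phi0 addr0 => ->; exact: divfK.
  by rewrite -phiu cx re_partK.
case: k E u uL u1 => /= E u uL u1.
  by exists u => // t x y; rewrite uL.
have u0 : u 0 = 0 by have := uL (-1) 0 0; rewrite scaler0 addr0 mulN1r addNr.
have uZ t x : u (t%:C%C *: x) = t * u x by have := uL t x 0; rewrite u0 !addr0.
have uD x y : u (x + y) = u x + u y.
  by have := uL 1 x y; rewrite rmorph1 scale1r mul1r.
exists (fun x => (u x +i* (- u ('i%C *: x)))%C) => // -[a b] x y.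
have -> : (a +i* b)%C = a%:C%C + b%:C%C * 'i%C.
  by apply/eqP; rewrite eq_complex /=; apply/andP; split; apply/eqP; ring.
have iZ t v : 'i%C *: (t%:C%C *: v) = t%:C%C *: ('i%C *: v) :> E.
  by rewrite !scalerA mulrC.
have uii v : u ('i%C *: ('i%C *: v)) = - u v.
  rewrite scalerA (_ : 'i%C * 'i%C = (-1)%:C%C) ?uZ ?mulN1r//.
  by rewrite -expr2 sqr_i rmorphN1.
rewrite !scalerDl -!scalerA !scalerDr !iZ !uD !uZ uii.
apply/eqP; rewrite eq_complex /=; apply/andP; split; apply/eqP; ring.
Qed.

(** * State spaces, and adjoints of contractions *)

Section dual_space.
Variables (R : realType) (k : scalar_kind).
Local Notation K := (scalar_field R k).
Implicit Types E F : normedModType K.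

Lemma dual_contractionE E (phi : E -> K^o) :
  linear phi -> (forall x, `|phi x| <= `|x|) ->
  exists psi : dual E, psi = phi :> (E -> K^o).
Proof.
move=> lphi phi1.
have phiP : phi \in @functional_pred R k E.
  rewrite inE; split=> //.
  pose phiL := HB.pack_for {linear E -> K^o} phi
    (GRing.isLinear.Build K E K^o *:%R phi lphi).
  apply: (@linear_bound_continuous _ _ _ phiL 1) => // x.
  by rewrite mul1r; exact: phi1.
by exists (Dual phiP).
Qed.

(** This trades the operator norm for pointwise bounds: a contraction with value 1 at the unit
    vector [e] attains norm 1 there. *)
Lemma state_spaceP E (e : E) (phi : dual E) : `|e| = 1 ->
  state_space e phi <-> phi e = 1 /\ forall x, `|phi x| <= `|x|.
Proof.
move=> e1; split=> [[phi1 phie]|[phie phi1]].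
  split=> // x; apply: le_trans (le_op_norm phi x) _.
  by rewrite [op_norm phi]phi1 mul1r.
split=> //; apply/eqP; rewrite eq_le; apply/andP; split.
  by apply: op_norm_le => // x x1; exact: le_trans (phi1 x) x1.
by rewrite -[leLHS](@normr1 K) -phie; apply: op_norm_ub; rewrite e1.
Qed.

(** Hahn-Banach with [p] the norm gives a contraction whose value at [e] has real part 1; having
    modulus at most 1, that value is 1. *)
Lemma state_space_neq0 E (e : E) : `|e| = 1 -> state_space e !=set0.
Proof.
move=> e1; pose p (x : E) := re_part `|x|.
have pE x : of_real k (p x) = `|x| by rewrite re_partK.
have [||u [uL up ue]] := @hahn_banach R K (@of_real R k) E p _ _ e.
- move=> x y; have := ler_normD x y.
  by rewrite -!pE -(rmorphD (@of_real R k)) ler_of_real.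
- move=> t x t0; apply: (can_inj (@of_realK R k)).
  by rewrite rmorphM /= !pE normrZ normr_of_real gtr0_norm.
have [|phi [phiL phi1 phiu]] := functional_of_real_part uL.
  by move=> x; rewrite -pE ler_of_real.
have [psi psiE] := dual_contractionE phiL phi1.
exists psi; apply/state_spaceP => //; rewrite psiE; split=> //.
apply: eq1_re_part; first by rewrite -e1.
rewrite phiu ue; apply: (can_inj (@of_realK R k)).
by rewrite pE e1 rmorph1.
Qed.
Definition dual_eval E (e : E) (phi : dual E) : K^o := phi e.

Lemma dual_eval_linear E (e : E) : linear (@dual_eval E e).
Proof. by []. Qed.

HB.instance Definition _ E (e : E) := GRing.isLinear.Build K (dual E) K^o *:%R
  (@dual_eval E e) (@dual_eval_linear E e).

Lemma dual_eval_continuous E (e : E) : continuous (@dual_eval E e).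
Proof.
apply: (@linear_bound_continuous _ _ _ (@dual_eval E e) `|e|) => // phi.
by rewrite mulrC; exact: le_op_norm.
Qed.

Lemma state_space_closed E (e : E) : closed (state_space e).
Proof.
have -> : state_space e =
    (fun phi : dual E => `|phi| : K^o) @^-1` [set 1] `&`
    dual_eval e @^-1` [set 1].
  by [].
have c1 : closed [set (1 : K^o)].
  exact/accessible_closed_set1/hausdorff_accessible/norm_hausdorff.
apply: closedI; apply: preimage_closed => // phi _.
  exact: norm_continuous.
exact: dual_eval_continuous.
Qed.

Section pullback.
Variables (E F : normedModType K) (T : {linear E -> F}).
Hypothesis T1 : forall x, `|T x| <= `|x|.

Lemma pullback_subproof (phi : dual F) :
  ((phi : F -> K^o) \o T : E -> K^o) \in @functional_pred R k E.
Proof.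
rewrite inE; split=> [a x y|x]; first by rewrite /= linearP dual_linear.
apply: (@continuous_comp _ _ _ T phi); last exact: dual_continuous.
by apply: (@linear_bound_continuous _ _ _ T 1) => // y; rewrite mul1r.
Qed.

(** The adjoint of the contraction [T]. It is applied to point evaluations and to multiplication of
    vectors by a scalar function. *)
Definition pullback (phi : dual F) : dual E := Dual (pullback_subproof phi).

Lemma pullback_linear : linear pullback.
Proof. by move=> a phi psi; apply/val_inj/funext. Qed.

HB.instance Definition _ :=
  GRing.isLinear.Build K (dual F) (dual E) *:%R pullback pullback_linear.

Lemma ler_norm_pullback phi : `|pullback phi| <= `|phi|.
Proof.
apply: op_norm_le => // x x1 /=; apply: le_trans (le_op_norm _ _) _.
by rewrite ler_piMr// ?op_norm_ge0// (le_trans (T1 x)).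
Qed.

Lemma pullback_continuous : continuous pullback.
Proof.
apply: (@linear_bound_continuous _ _ _ pullback 1) => // phi.
by rewrite mul1r ler_norm_pullback.
Qed.

End pullback.

End dual_space.

(** * Point evaluations, bump functions with vector values, and Urysohn functions *)

Section cfun_maps.
Variables (R : realType) (k : scalar_kind).
Local Notation K := (scalar_field R k).
Variables (Omega : compactHausdorffType) (X : normedModType K).
Local Notation C := (cfun Omega X).

Definition cfun_eval (w : Omega) (g : C) : X := g w.

Lemma cfun_eval_linear w : linear (cfun_eval w).
Proof. by []. Qed.

HB.instance Definition _ w :=
  GRing.isLinear.Build K C X *:%R (cfun_eval w) (cfun_eval_linear w).

Lemma cfun_eval_le w g : `|cfun_eval w g| <= `|g|.
Proof. exact: sup_norm_ub. Qed.

Section bump.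
Variable v : Omega -> K^o.
Hypotheses (cv : continuous v) (v1 : forall w, `|v w| <= 1).

Lemma bump_subproof x :
  (fun w => v w *: x : X) \in @continuous_pred R k Omega X.
Proof. by rewrite inE => w; apply: cvgZl; exact: cv. Qed.

Definition bump (x : X) : C := CFun (bump_subproof x).

Lemma bump_linear : linear bump.
Proof.
move=> a x y; apply/val_inj/funext => w.
rewrite [LHS]/= [RHS](_ : _ = a *: (v w *: x) + v w *: y)//.
by rewrite scalerDr !scalerA mulrC.
Qed.

HB.instance Definition _ :=
  GRing.isLinear.Build K X C *:%R bump bump_linear.

Lemma bump_le x : `|bump x| <= `|x|.
Proof. by apply: sup_norm_le => // w; rewrite normrZ ler_piMl. Qed.

End bump.

Lemma urysohn_scalar (w : Omega) (B : set Omega) : closed B -> ~ B w ->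
  exists v : Omega -> K^o, [/\ continuous v, forall u, `|v u| <= 1,
    v w = 1 & forall u, B u -> v u = 0].
Proof.
move=> cB Bw.
have cw : closed [set w].
  exact/accessible_closed_set1/hausdorff_accessible/hausdorff.
have wB : B `&` [set w] = set0.
  by apply/eqP/negP => /negP/set0P[u [Bu]] /= uw; apply: Bw; rewrite -uw.
have nO : normal_space Omega.
  exact: compact_normal hausdorff compact_setT.
have /(@uniform_separatorP _ R)[h [ch h01 h0 h1]] :=
  normal_uniform_separator nO cB cw wB.
exists (@of_real R k \o h); split.
- by move=> u; apply: continuous_comp; [exact: ch|exact: of_real_continuous].
- move=> u; rewrite normr_of_real -(rmorph1 (@of_real R k)) ler_of_real.
  have /h01 /= : range h (h u) by exists u.
  by rewrite in_itv /= => /andP[hu0 hu1]; rewrite ger0_norm.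
- by rewrite /= (h1 (h w)) ?rmorph1//; exists w.
- by move=> u Bu; rewrite /= (h0 (h u)) ?rmorph0//; exists u.
Qed.

End cfun_maps.

(** By induction on [s], [D] is the iterated image of a product of compact sets under addition. *)
Lemma compact_sum (K : numFieldType) (V : normedModType K) (I : eqType)
    (s : seq I) (C : I -> set V) : (forall i, i \in s -> compact (C i)) ->
  exists2 D, compact D &
    forall x, (forall i, i \in s -> C i (x i)) -> D (\sum_(i <- s) x i).
Proof.
elim: s => [|i s IH] cC.
  by exists [set 0]; [exact: compact_set1|move=> x _; rewrite big_nil].
have [|D cD DP] := IH; first by move=> j js; apply: cC; rewrite inE js orbT.
exists ((fun z => z.1 + z.2) @` (C i `*` D)).
  apply: continuous_compact.
    by apply: continuous_subspaceT; exact: add_continuous.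
  by apply: compact_setX => //; apply: cC; rewrite mem_head.
move=> x Cx; exists (x i, \sum_(j <- s) x j); last by rewrite big_cons.
split; first by apply: Cx; rewrite mem_head.
by apply: DP => j js; apply: Cx; rewrite inE js orbT.
Qed.

(** * States at a unit vector of [C(Omega, X)] *)

Section state_space_cfun.
Variables (R : realType) (k : scalar_kind).
Local Notation K := (scalar_field R k).
Variables (Omega : compactHausdorffType) (X : normedModType K).
Local Notation C := (cfun Omega X).
Variables (f : C) (f1 : `|f| = 1).

(* Off the set where f peaks, T f + g stays below T for T large. *)
Lemma peak_bound (g : C) (M : K) : 0 < M ->
  (forall w, `|f w| = 1 -> `|g w| < M) ->
  exists2 T : K, 0 <= T & forall w, `|T *: f w| + `|g w| <= T + M.
Proof.
move=> M0 gM.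
have fle w : `|f w| <= 1 by rewrite -f1; exact: sup_norm_ub.
suff : \forall T \near +oo_K,
    [set: Omega] `<=` [set w | 0 <= T /\ T * `|f w| + `|g w| <= T + M].
  (* The sign of [T] is recorded pointwise, so a point of [Omega] is needed to read it off; there is
     one because [f] is nonzero. *)
  have [w0 _] : [set: Omega] !=set0.
    apply/set0P/eqP => O0; have : `|f| <= 0.
      by apply: sup_norm_le => // w; have : [set: Omega] w by []; rewrite O0.
    by rewrite f1 ler10.
  move=> /filter_ex[T TP]; exists T; first by have [] := TP w0 I.
  by move=> w; have [T0 ?] := TP w I; rewrite normrZ ger0_norm.
apply: ((compact_near_coveringP [set: Omega]).1 compact_setT) => w _.
have near_le (h : C) (a b : K) : `|h w| <= a -> a < b ->
    \forall u \near w, `|h u| <= b.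
  move=> ha ab; have /cvgrPdist_le := @cfun_continuous _ _ _ _ h w.
  move=> /(_ (b - a)); rewrite subr_gt0 => /(_ ab); apply: filterS => u hu.
  rewrite -[h u](subKr (h w)) (le_trans (ler_normB _ _))//.
  by rewrite -[b](subrK a) addrC lerD.
have [fw1|fwn1] := eqVneq `|f w| 1.
  exists ([set u | `|g u| <= M], [set T | 0 <= T]) => /=.
    split; last by apply: nbhs_pinfty_ge; exact: real0.
    exact: (near_le g _ _ (lexx _) (gM w fw1)).
  case=> u T /= [gu T0]; split=> //.
  by rewrite lerD// ler_piMr.
have fwlt : `|f w| < 1 by rewrite lt_neqAle fwn1 fle.
(* Half the gap below 1: near [w] the norm of [f] stays below [1 - s], and [T s >= |g w| + 1] then
   absorbs the norm of [g]. *)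
pose s : K := (1 - `|f w|) / 2.
have s0 : 0 < s by rewrite divr_gt0// subr_gt0.
have fs : `|f w| < 1 - s.
  rewrite ltrBrDr -ltrBrDl /s ltr_pdivrMr// mulrDr mulr1 ltrDl subr_gt0//.
exists ([set u | `|f u| <= 1 - s /\ `|g u| <= `|g w| + 1],
        [set T | (`|g w| + 1) / s <= T]) => /=.
  split; last first.
    by apply: nbhs_pinfty_ge; rewrite ger0_real// divr_ge0 ?addr_ge0// ltW.
  by apply: filterI; [exact: (near_le f _ _ (lexx _))|
    apply: (near_le g _ _ (lexx _)); rewrite ltrDl].
case=> u T /= [[fu gu] Ts].
have T0 : 0 <= T by apply: le_trans Ts; rewrite divr_ge0 ?addr_ge0// ltW.
split=> //; apply: (@le_trans _ _ (T * (1 - s) + T * s)).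
  by rewrite lerD ?ler_wpM2l// (le_trans gu)// -ler_pdivrMr.
by rewrite -mulrDr subrK mulr1 lerDl ltW.
Qed.

Lemma state_space_le (phi : dual C) (g : C) (M : K) : state_space f phi ->
  0 <= M -> (forall w, `|f w| = 1 -> `|g w| <= M) -> `|phi g| <= M.
Proof.
move=> /(state_spaceP _ f1)[phif phi1] M0 gM.
have [->|z0] := eqVneq (phi g) 0; first by rewrite normr0.
(* The slack [e] supplies the strict inequality on the peak set that [peak_bound] asks for. *)
apply/ler_addgt0Pr => e e0.
have Me0 : 0 < M + e by rewrite ltr_wpDl.
have [|T T0 TP] := @peak_bound g (M + e) Me0.
  by move=> w fw; rewrite (le_lt_trans (gM w fw))// ltrDl.
(* The unimodular [c] rotates [phi g] to [|phi g|], which then adds to [T] without cancellation. *)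
pose c := `|phi g| / phi g.
have c1 : `|c| = 1 by rewrite normrM normr_id normfV mulfV ?normr_eq0.
have phiTg : phi (T *: f + c *: g) = T + `|phi g|.
  rewrite linearD !linearZ /= phif; congr +%R; first exact: mulr1.
  exact: divfK.
have := phi1 (T *: f + c *: g); rewrite phiTg.
rewrite ger0_norm ?addr_ge0// => h.
rewrite -(lerD2l T); apply: le_trans h _.
apply: sup_norm_le => [|w]; first by rewrite addr_ge0// ltW.
rewrite (le_trans (ler_normD _ _))//.
by rewrite [X in _ + X]normrZ c1 mul1r; exact: TP.
Qed.

Lemma state_space_eval w phi : `|f w| = 1 -> state_space (f w) phi ->
  state_space f (pullback (@cfun_eval_le _ _ _ X w) phi).
Proof.
move=> fw /(state_spaceP _ fw)[phif phi1]; apply/state_spaceP => //.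
split=> // x /=; exact: le_trans (phi1 _) (cfun_eval_le w x).
Qed.

Section bump_part.
Variables (v : Omega -> K^o) (w : Omega).
Hypotheses (cv : continuous v) (v1 : forall u, `|v u| <= 1).
Hypotheses (fw : `|f w| = 1) (vw : v w = 1).
Hypothesis v0 : forall u, `|f u| = 1 -> u != w -> v u = 0.

Let part := pullback (@bump_le R k Omega X v cv v1).

(* Compare f with f + v (c x - f w), which is bounded by 1 where f peaks. *)
Lemma bump_part_disc phi x : state_space f phi -> `|x| <= 1 ->
  `|1 - part phi (f w) + `|part phi x| | <= 1.
Proof.
move=> Sphi x1; set z := part phi (f w).
have [_ phif] := Sphi.
have [c c1 cx] : exists2 c : K, `|c| = 1 & part phi (c *: x) = `|part phi x|.
  have [p0|p0] := eqVneq (part phi x) 0.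
    by exists 1; rewrite ?normr1// scale1r p0 normr0.
  exists (`|part phi x| / part phi x).
    by rewrite normrM normr_id normfV mulfV ?normr_eq0.
  by rewrite linearZ; exact: divfK.
pose h : C := f + bump cv (c *: x - f w).
have -> : 1 - z + `|part phi x| = phi h.
  have -> : phi h = phi f + (part phi (c *: x) - part phi (f w)).
    by rewrite /h linearD -linearB.
  by rewrite cx phif addrA addrAC.
apply: (state_space_le Sphi) => // u fu.
rewrite [h u](_ : _ = f u + v u *: (c *: x - f w))//.
have [->|uw] := eqVneq u w; last by rewrite v0// scale0r addr0 fu.
by rewrite vw scale1r addrC subrK normrZ c1 mul1r.
Qed.

(** Let [z] be the value of [part phi] at [f w]. The disc estimate at [x = f w] makes [z] a
    nonnegative real; at a general [x] it gives [|part phi x| <= z]. So [part phi] has norm [z], and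
    dividing by [z] yields a state. *)
Lemma bump_partE phi : state_space f phi ->
  exists t psi, [/\ 0 <= t <= 1, state_space (f w) psi &
    part phi = of_real k t *: psi].
Proof.
move=> Sphi; set z := part phi (f w).
have zE : z = `|z| by apply: eq_normr_disc; apply: bump_part_disc; rewrite ?fw.
have z0 : 0 <= z by rewrite zE.
have phi1 x : `|x| <= 1 -> `|part phi x| <= z.
  move=> /(bump_part_disc Sphi); rewrite -/z => h.
  have r : 1 - z + `|part phi x| \is Num.real.
    by rewrite realD ?realB ?real1 ?ger0_real.
  have := le_trans (real_ler_norm r) h.
  by rewrite -addrA gerDl addrC subr_le0.
have z1 : z <= 1.
  rewrite zE; have [_ phi_le] := (state_spaceP phi f1).1 Sphi.
  by rewrite -fw (le_trans (phi_le _)) ?bump_le.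
have pz : `|part phi| <= z by exact: op_norm_le.
have tz : of_real k (re_part z) = z by exact: re_partK.
(* If [z = 0] then [part phi] vanishes, and any state at [f w] serves with weight 0. *)
exists (re_part z); have [z00|zn0] := eqVneq z 0.
  have [psi Spsi] := state_space_neq0 fw.
  exists psi; split=> //.
    by rewrite -!(ler_of_real k) tz rmorph0 rmorph1 z0.
  by rewrite tz z00 scale0r; apply/eqP; rewrite -normr_le0 -z00.
exists (z^-1 *: part phi); split.
- by rewrite -!(ler_of_real k) tz rmorph0 rmorph1 z0.
- apply/state_spaceP => //; split; first exact: mulVf.
  move=> x; rewrite [X in `|X|](_ : _ = z^-1 * part phi x)// normrM normfV -zE.
  rewrite ler_pdivrMl ?lt_def ?zn0//.
  by apply: le_trans (le_op_norm _ _) _; rewrite ler_wpM2r.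
- by rewrite tz scalerA mulfV// scale1r.
Qed.

End bump_part.

(** The summand at [w] is the part of [phi] cut out by a Urysohn function that is 1 at [w] and 0 at
    the other peaks. Only [0 <= t <= 1] is recorded for the weights, which is enough for
    compactness. *)
Lemma state_space_sum (s : seq Omega) phi : uniq s ->
  (forall w, (`|f w| == 1) = (w \in s)) -> state_space f phi ->
  exists chi : Omega -> dual C,
    (forall w, w \in s -> exists t psi, [/\ 0 <= t <= 1, state_space (f w) psi &
      chi w = of_real k t *: pullback (@cfun_eval_le _ _ _ X w) psi]) /\
    phi = \sum_(w <- s) chi w.
Proof.
move=> us sP Sphi.
have /choice[v vP] (w : Omega) : exists vw : Omega -> K^o,
    [/\ continuous vw, forall u, `|vw u| <= 1, vw w = 1 &
      forall u, u \in s -> u != w -> vw u = 0].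
  have cB : closed [set u | u \in s /\ u != w].
    apply: (accessible_finite_set_closed.1 (hausdorff_accessible hausdorff)).
    by apply: (@sub_finite_set _ _ [set` s]) => // u [].
  have [|h [ch h1 hw h0]] := @urysohn_scalar R k Omega w _ cB.
    by move=> [_]; rewrite eqxx.
  by exists h; split => // u us' uw; apply: h0.
have cv w : continuous (v w) by have [] := vP w.
have v1 w : forall u, `|v w u| <= 1 by have [] := vP w.
pose part w := pullback (@bump_le R k Omega X _ (cv w) (v1 w)) phi.
exists (fun w => pullback (@cfun_eval_le _ _ _ X w) (part w)); split.
  move=> w; rewrite -sP => /eqP fw; have [_ _ vw v0] := vP w.
  have [|t [psi [t01 Spsi partE]]] := bump_partE (cv w) (v1 w) fw vw _ Sphi.
    by move=> u /eqP; rewrite sP; exact: v0.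
  by exists t, psi; split=> //; rewrite /part partE linearZ.
apply/val_inj/funext => g /=.
rewrite -[RHS]/(dual_eval g _) raddf_sum /=.
apply/eqP; rewrite -subr_eq0 -normr_le0.
(* The function [g] minus its bumps vanishes wherever [f] peaks, so [state_space_le] applies with
   [M = 0]. *)
rewrite (_ : _ - _ = phi (g - \sum_(w <- s) bump (cv w) (g w))); last first.
  by rewrite [RHS]raddfB [X in _ = _ - X]raddf_sum.
apply: (state_space_le Sphi) => // u /eqP; rewrite sP => us'.
rewrite -[X in `|X|]/(cfun_eval u _) raddfB raddf_sum /= (bigD1_seq u)//=.
rewrite big1_seq ?addr0; last first.
  move=> w /andP[wu ws]; have [_ _ _ v0] := vP w.
  by rewrite /cfun_eval /= v0 ?scale0r// eq_sym.
have [_ _ vu _] := vP u.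
by rewrite /cfun_eval /= vu scale1r subrr normr0.
Qed.

(** * Compactness of the state spaces and finiteness of the peak set *)

Lemma finite_peak_compact :
  finite_set [set w | `|f w| = 1] ->
  (forall w, `|f w| = 1 -> compact (state_space (f w))) ->
  compact (state_space f).
Proof.
move=> /finite_seqP[s0 s0P] cS.
(* Each peak must occur once, or its part would be counted several times in the sum. *)
pose s := undup s0.
have sP w : (`|f w| == 1) = (w \in s).
  rewrite mem_undup; apply/eqP/idP => h.
    by have : [set` s0] w by rewrite -s0P.
  by have : [set w | `|f w| = 1] w by rewrite s0P.
pose lift w (z : R * dual X) : dual C :=
  of_real k z.1 *: pullback (@cfun_eval_le _ _ _ X w) z.2.
have [w ws|D cD DP] := @compact_sum K (dual C) Omega s
    (fun w => lift w @` (`[0, 1] `*` state_space (f w))).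
  apply: continuous_compact.
    apply: continuous_subspaceT => z.
    apply: cvgZ.
      by apply: continuous_comp; [exact: cvg_fst|exact: of_real_continuous].
    by apply: continuous_comp; [exact: cvg_snd|exact: pullback_continuous].
  apply: compact_setX; first exact: segment_compact.
  by apply: cS; apply/eqP; rewrite sP.
apply: (subclosed_compact _ cD); first exact: state_space_closed.
move=> phi Sphi; have [chi [chiP ->]] := state_space_sum (undup_uniq _) sP Sphi.
apply: DP => w /chiP[t [psi [t01 Spsi ->]]].
by exists (t, psi) => //; split.
Qed.

(** Restriction to constant functions, [cst], is a left inverse of [ev]. Hence [state_space (f w)]
    is the continuous image under [cst] of the closed part of [state_space f] fixed by
    [ev \o cst]. *)
Lemma compact_peak_state_space w : `|f w| = 1 ->
  compact (state_space f) -> compact (state_space (f w)).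
Proof.
move=> fw cS.
have cc : continuous (fun _ : Omega => 1 : K^o) by move=> ?; exact: cvg_cst.
have c1 (u : Omega) : `|1 : K^o| <= 1 by rewrite normr1.
pose cst := pullback (@bump_le R k Omega X _ cc c1).
pose ev := pullback (@cfun_eval_le _ _ _ X w).
have evK phi : cst (ev phi) = phi.
  by apply/val_inj/funext => x /=; rewrite scale1r.
have cevcst : continuous (ev \o cst).
  by move=> phi; apply: continuous_comp; exact: pullback_continuous.
have cD : continuous (fun phi : dual C => (ev \o cst) phi - phi).
  by move=> phi; apply: (@cvgB _ (dual C) (dual C) (nbhs phi) _ (ev \o cst) id);
    [exact: cevcst|exact: cvg_id].
rewrite (_ : state_space _ =
    cst @` (state_space f `&` [set phi | ev (cst phi) - phi = 0])).
  apply: continuous_compact.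
    by apply: continuous_subspaceT; exact: pullback_continuous.
  apply: compact_closedI => //.
  apply: (@preimage_closed _ _ (fun phi => ev (cst phi) - phi) [set 0]).
    by move=> phi _; exact: cD.
  exact/accessible_closed_set1/hausdorff_accessible/norm_hausdorff.
apply/seteqP; split=> [psi Spsi|_ [phi [Sphi /subr0_eq phiE] <-]].
  exists (ev psi) => //; split; first exact: state_space_eval.
  by rewrite /= evK subrr.
apply/state_spaceP => //; have [phif phi1] := (state_spaceP phi f1).1 Sphi.
split; first by rewrite -[LHS]/(ev (cst phi) f) phiE.
by move=> x; apply: le_trans (phi1 _) (bump_le cc c1 x).
Qed.

(** The difference is tested on [v f(w)], where the Urysohn function [v] is 1 at [w] and 0 at [u]:
    the first functional gives 1 and the second 0. *)
Lemma state_space_eval_dist w u phi psi : w != u ->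
  `|f w| = 1 -> state_space (f w) phi ->
  1 <= `|pullback (@cfun_eval_le _ _ _ X w) phi -
         pullback (@cfun_eval_le _ _ _ X u) psi|.
Proof.
move=> wu fw /(state_spaceP _ fw)[phif _].
have cu : closed [set u].
  exact/accessible_closed_set1/hausdorff_accessible/hausdorff.
have [|v [cv v1 vw vu]] := @urysohn_scalar R k Omega w _ cu.
  by move=> /= wu'; rewrite wu' eqxx in wu.
set d := _ - _; have -> : 1 = `|d (bump cv (f w))|.
  rewrite [d _](_ : _ = phi (v w *: f w) - psi (v u *: f w))//.
  by rewrite vw vu// scale1r scale0r phif linear0 subr0 normr1.
by apply: op_norm_ub; rewrite (le_trans (bump_le _ _ _))// fw.
Qed.

(** An infinite peak set would give an infinite family in [state_space f] with mutual distances at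
    least 1, which no compact set contains. *)
Lemma compact_state_space_finite_peak : compact (state_space f) ->
  finite_set [set w | `|f w| = 1].
Proof.
move=> cS; apply: contrapT => Linf.
have /choice[psi psiP] (w : Omega) :
    exists psi : dual X, `|f w| = 1 -> state_space (f w) psi.
  (* Where [f] does not peak, 0 is a mere default. *)
  have [fw|/eqP fw] := eqVneq `|f w| 1; last by exists 0.
  by have [psi Spsi] := state_space_neq0 fw; exists psi.
pose chi w := pullback (@cfun_eval_le _ _ _ X w) (psi w).
(* the image under chi of the cofinite filter on the peak set of f *)
pose F : set_system (dual C) :=
  [set A | finite_set [set w | `|f w| = 1 /\ ~ A (chi w)]].
have FF : ProperFilter F.
  split.
    by move=> fin; apply: Linf; apply: sub_finite_set fin => w fw;
      split=> // -[].
  split=> [|A B FA FB|A B AB FA].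
  - by apply: sub_finite_set (finite_set0 _) => w [_ []].
  - apply: (@sub_finite_set _ _ ([set w | `|f w| = 1 /\ ~ A (chi w)] `|`
        [set w | `|f w| = 1 /\ ~ B (chi w)])); last by rewrite finite_setU.
    by move=> w [fw /not_andP[?|?]]; [left|right].
  - by apply: sub_finite_set FA => w [fw nB]; split=> // /AB.
have [|p [_ clp]] := cS F FF.
  apply: sub_finite_set (finite_set0 _) => w [fw]; apply.
  exact: state_space_eval (psiP _ fw).
have h0 : 0 < 2^-1 :> K by rewrite invr_gt0.
(* By the separation, the ball of radius 1/2 around the cluster point [p] contains [chi w] for at
   most one peak [w]. Its complement therefore belongs to [F], and clustering at [p] makes it meet
   the ball. *)
have : (~` ball p 2^-1 `&` ball p 2^-1) !=set0.
  apply: clp; last exact: nbhsx_ballx.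
  have [[w0 [fw0 bw0]]|none] :=
      pselect (exists w, `|f w| = 1 /\ ball p 2^-1 (chi w)).
    apply: sub_finite_set (finite_set1 w0) => w [fw /= /contrapT bw].
    apply/eqP/negP => /negP ww0.
    have := state_space_eval_dist (psi w0) ww0 fw (psiP _ fw).
    rewrite -/(chi w) -/(chi w0) => /le_lt_trans-/(_ 1).
    rewrite ltxx => contra; suff : false by []; apply: contra.
    rewrite -(subrKA p) (le_lt_trans (ler_normD _ _))// (splitr 1) div1r.
    move: bw bw0; rewrite -!ball_normE /= distrC => bw bw0.
    exact: ltrD.
  apply: sub_finite_set (finite_set0 _) => w [fw /contrapT bw].
  by apply: none; exists w.
by case=> q [].
Qed.

End state_space_cfun.

Theorem corollary3p11 (R : realType) (k : scalar_kind)
    (Omega : compactHausdorffType)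
    (X : completeNormedModType (scalar_field R k))
    (f : cfun Omega X) (f_sphere : unit_sphere (cfun Omega X) f) :
  let Lambda : set Omega := [set w | `|f w| = 1] in
  (finite_set Lambda ->
   (forall w : Omega, Lambda w -> compact (state_space (f w))) ->
   compact (state_space f)) /\
  (weak_star_closure (extreme_points (unit_ball (dual X)))
     `<=` unit_sphere (dual X) ->
   compact (state_space f) ->
   finite_set Lambda /\
   (forall w : Omega, Lambda w -> compact (state_space (f w)))).
Proof.
split=> [Lfin cS|_ cS]; first exact: finite_peak_compact.
split; first exact: compact_state_space_finite_peak.
by move=> w fw; exact: compact_peak_state_space cS.
Qed.
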